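(* Let $w_1,\dots,w_n$ be positive real numbers, let $H_{\mathfrak W}=\prod_{k=1}^n\{0,w_k\}\subseteq\mathbb R^n$ be equipped with the $\ell^1$ metric, and let $X$ be an affinely independent subset of $H_{\mathfrak W}$ with at least two points. Then $$\langle D_X^{-1}\mathbf 1,\mathbf 1\rangle\ \ge\ 2\Bigl(\sum_{k=1}^n w_k\Bigr)^{-1},$$ with equality if and only if $\boldsymbol h\in Z_X$.
   Context: $D_X$ is the distance matrix of $X$ in the $\ell^1$ metric (it is invertible whenever $X\subseteq H_{\mathfrak W}$ is affinely independent with at least two points), $\langle\cdot,\cdot\rangle$ is the usual inner product and $\mathbf 1$ is the all-ones vector, so $\langle D_X^{-1}\mathbf 1,\mathbf 1\rangle$ is the sum of the entries of $D_X^{-1}$. Let $W=\mathrm{diag}(w_1,\dots,w_n)$ and $\iota(\boldsymbol x)=W^{-1/2}\boldsymbol x$ for $\boldsymbol x\in\mathbb R^n$. $Z_X$ is the smallest affine subspace of $\mathbb R^n$ containing $\iota(X)$, and $\boldsymbol h=\frac12(\sqrt{w_1},\dots,\sqrt{w_n})^T$. *)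

(* Defs.v *)
From HB Require Import structures.
From mathcomp Require Import all_boot all_order all_algebra.
From mathcomp Require Import finmap.
Set Implicit Arguments.
Unset Strict Implicit.
Unset Printing Implicit Defensive.
Import Order.TTheory GRing.Theory Num.Theory.
Local Open Scope ring_scope.

Definition inner (R : rcfType) (m : nat) (u v : 'cV[R]_m) : R :=
  \sum_i u i 0 * v i 0.

Definition ones (R : rcfType) (m : nat) : 'cV[R]_m := const_mx 1.

Definition l1dist (R : rcfType) (n : nat) (x y : 'cV[R]_n) : R :=
  \sum_k `|x k 0 - y k 0|.

Definition weighted_cube (R : rcfType) (n : nat) (w : 'I_n -> R) :
    pred 'cV[R]_n :=
  fun x => [forall k, (x k 0 == 0) || (x k 0 == w k)].

Definition affinely_independent (R : rcfType) (n : nat)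
    (X : {fset 'cV[R]_n}) : Prop :=
  forall c : 'cV[R]_n -> R,
    \sum_(x <- enum_fset X) c x = 0 ->
    \sum_(x <- enum_fset X) c x *: x = 0 ->
    forall x, x \in X -> c x = 0.

(* The rows and columns are indexed by the positions in the enumeration of X;
   a change of enumeration conjugates the matrix by a permutation matrix. *)
Definition distance_matrix (R : rcfType) (n : nat) (X : {fset 'cV[R]_n}) :
    'M[R]_#|` X| :=
  \matrix_(i, j) l1dist (enum_fset X)`_i (enum_fset X)`_j.

Definition iota_w (R : rcfType) (n : nat) (w : 'I_n -> R) (x : 'cV[R]_n) :
    'cV[R]_n :=
  diag_mx (\row_k (Num.sqrt (w k))^-1) *m x.

Definition affine_subspace (R : rcfType) (n : nat) (Z : 'cV[R]_n -> Prop) :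
    Prop :=
  exists (a : 'cV[R]_n) (V : {vspace 'cV[R]_n}),
    forall v, Z v <-> v - a \in V.

Definition affine_hull (R : rcfType) (n : nat) (S : 'cV[R]_n -> Prop) :
    'cV[R]_n -> Prop :=
  fun v => forall Z : 'cV[R]_n -> Prop,
    affine_subspace Z -> (forall u, S u -> Z u) -> Z v.

Definition Z_of (R : rcfType) (n : nat) (w : 'I_n -> R)
    (X : {fset 'cV[R]_n}) : 'cV[R]_n -> Prop :=
  affine_hull (fun u => exists2 x, x \in X & u = iota_w w x).

Definition h_vec (R : rcfType) (n : nat) (w : 'I_n -> R) : 'cV[R]_n :=
  2^-1 *: \col_k Num.sqrt (w k).

(* Main.v *)
Require Import Defs.
From HB Require Import structures.
From mathcomp Require Import all_boot all_order all_algebra.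
From mathcomp Require Import finmap.
From mathcomp Require Import ring lra.

(** On the cube, |x k - y k| is either 0 or w k, hence equals
    (x k - y k)^2 / w k; so the l1 distance of x and y is the squared Euclidean
    distance of iota x and iota y.  Moreover every iota x lies on the sphere of
    centre h and squared radius rho = (\sum_k w k) / 4.  The theorem is thus a
    statement about affinely independent points y_i = iota x_i - h on a sphere
    around the origin and their matrix D of squared distances.

    Let D c = 1, with s the sum of the c_i and v = \sum_i c_i y_i.  Expanding
    |y_i - y_j|^2 = 2 rho - 2 <y_i, y_j> gives ([circumcenter_eqs])
<<
      s = 2 rho s^2 - 2 |v|^2   and   s = 2 |s y_i - v|^2 for every i.
>>
    Geometrically, u = v / s is the circumcentre of the simplex spanned by the
    y_i, its circumradius r satisfies s = 1 / (2 r^2), and Pythagoras gives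
    r^2 = rho - |u|^2.  Therefore s >= 1 / (2 rho), with equality exactly when
    u = 0, that is, when the origin is an affine combination of the y_i
    ([sum_inv_sqdist_matrix]); undoing the translation by h, this says that h
    lies in the affine hull of the points iota x_i ([affine_hull_familyP]).
    The same identities with right-hand side 0 in place of 1 show that D has
    trivial kernel ([sqdist_matrix_unit]). *)

Import Order.TTheory GRing.Theory Num.Theory.
Local Open Scope ring_scope.
Set Implicit Arguments.
Unset Strict Implicit.

(** * Linear algebra of column vectors *)

Lemma cVsubE (R : rcfType) (m : nat) (u v : 'cV[R]_m) i :
  (u - v) i 0 = u i 0 - v i 0.
Proof. by rewrite !mxE. Qed.

Lemma innerC (R : rcfType) (m : nat) (u v : 'cV[R]_m) : inner u v = inner v u.
Proof. by apply: eq_bigr => i _; rewrite mulrC. Qed.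

Lemma innerDl (R : rcfType) (m : nat) (u1 u2 v : 'cV[R]_m) :
  inner (u1 + u2) v = inner u1 v + inner u2 v.
Proof. by rewrite -big_split; apply: eq_bigr => i _; rewrite mxE mulrDl. Qed.

Lemma innerZl (R : rcfType) (m : nat) (a : R) (u v : 'cV[R]_m) :
  inner (a *: u) v = a * inner u v.
Proof. by rewrite /inner mulr_sumr; apply: eq_bigr => i _; rewrite mxE mulrA. Qed.

Lemma inner_suml (R : rcfType) (m p : nat) (u : 'I_p -> 'cV[R]_m)
    (v : 'cV[R]_m) :
  inner (\sum_j u j) v = \sum_j inner (u j) v.
Proof.
rewrite exchange_big; apply: eq_bigr => i _.
by rewrite summxE mulr_suml.
Qed.

Lemma inner_subZ_sqr (R : rcfType) (m : nat) (a : R) (u v : 'cV[R]_m) :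
  inner (a *: u - v) (a *: u - v)
  = a ^+ 2 * inner u u - 2 * a * inner u v + inner v v.
Proof.
rewrite innerDl innerZl -scaleN1r innerZl !(innerC _ (_ + _)) !innerDl.
rewrite !innerZl (innerC v u); ring.
Qed.

Lemma inner_ge0 (R : rcfType) (m : nat) (u : 'cV[R]_m) : 0 <= inner u u.
Proof. by apply: sumr_ge0 => i _; rewrite -expr2 sqr_ge0. Qed.

Lemma inner_eq0 (R : rcfType) (m : nat) (u : 'cV[R]_m) :
  (inner u u == 0) = (u == 0).
Proof.
apply/eqP/eqP => [u0|->]; last by rewrite /inner big1 // => i _; rewrite mxE mul0r.
apply/matrixP => i j; rewrite ord1 mxE.
have /(_ i isT)/eqP := psumr_eq0P (fun i _ => (sqr_ge0 (u i 0) : 0 <= u i 0 ^+ 2)) u0.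
by rewrite sqrf_eq0 => /eqP.
Qed.

Lemma inner_ones (R : rcfType) (m : nat) (u : 'cV[R]_m) :
  inner u (ones R m) = \sum_i u i 0.
Proof. by apply: eq_bigr => i _; rewrite mxE mulr1. Qed.

Lemma sum_delta_scale (R : nzRingType) (V : lmodType R) (m : nat) (i0 : 'I_m)
    (f : 'I_m -> V) :
  \sum_i (i == i0)%:R *: f i = f i0.
Proof.
rewrite (bigD1 i0) //= eqxx scale1r big1 ?addr0 // => i /negPf->.
by rewrite scale0r.
Qed.

Lemma unitmx_ker0 (F : fieldType) (m : nat) (A : 'M[F]_m) :
  (forall c : 'cV[F]_m, A *m c = 0 -> c = 0) -> A \in unitmx.
Proof.
move=> ker0; rewrite -unitmx_tr -row_free_unit -kermx_eq0.
apply/eqP/row_matrixP => i; rewrite row0; apply: trmx_inj; rewrite trmx0.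
by apply: ker0; rewrite -[X in X *m _]trmxK -trmx_mul -row_mul mulmx_ker row0 trmx0.
Qed.

(** * Points on a sphere *)

Definition sqdist_matrix (R : rcfType) (n m : nat) (y : 'I_m -> 'cV[R]_n) :
    'M[R]_m :=
  \matrix_(i, j) inner (y i - y j) (y i - y j).

Definition affinely_independent_family (R : rcfType) (n m : nat)
    (y : 'I_m -> 'cV[R]_n) : Prop :=
  forall c : 'cV[R]_m,
    \sum_i c i 0 = 0 -> \sum_i c i 0 *: y i = 0 -> c = 0.

Lemma sqdist_matrix_mulE (R : rcfType) (n m : nat) (y : 'I_m -> 'cV[R]_n)
    (rho : R) (c : 'cV[R]_m) (i : 'I_m) :
  (forall j, inner (y j) (y j) = rho) ->
  (sqdist_matrix y *m c) i 0
  = 2 * rho * (\sum_j c j 0) - 2 * inner (y i) (\sum_j c j 0 *: y j).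
Proof.
move=> y_sph; rewrite (innerC (y i)) inner_suml !mulr_sumr -sumrB mxE.
apply: eq_bigr => j _; rewrite innerZl mxE.
rewrite -{1 2}(scale1r (y i)) inner_subZ_sqr !y_sph (innerC (y j)); ring.
Qed.

(** Weighting the rows of D c = lam 1 by the c_i gives the first identity;
    inserting a single row into the expansion of |s y_i - v|^2 and using the
    first identity gives the second.  The right-hand side lam is kept general
    because lam = 0 governs the kernel of D and lam = 1 the sum of the entries
    of its inverse. *)
Lemma circumcenter_eqs (R : rcfType) (n m : nat) (y : 'I_m -> 'cV[R]_n)
    (rho lam : R) (c : 'cV[R]_m) (s := \sum_j c j 0)
    (v := \sum_j c j 0 *: y j) :
  (forall j, inner (y j) (y j) = rho) ->
  sqdist_matrix y *m c = lam *: ones R m ->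
  lam * s = 2 * rho * s ^+ 2 - 2 * inner v v
  /\ forall i, lam * s = 2 * inner (s *: y i - v) (s *: y i - v).
Proof.
move=> y_sph Dc.
have row i : lam = 2 * rho * s - 2 * inner (y i) v.
  by rewrite -(sqdist_matrix_mulE _ _ y_sph) Dc !mxE mulr1.
have total : lam * s = 2 * rho * s ^+ 2 - 2 * inner v v.
  rewrite {2}/v inner_suml {1}/s !mulr_sumr.
  rewrite expr2 mulrA {2}/s mulr_sumr -sumrB.
  by apply: eq_bigr => j _; rewrite {1}(row j) innerZl; ring.
split=> // i; rewrite inner_subZ_sqr y_sph.
have := row i; nra.
Qed.

(** If D c = 0, then s y_i = v for every i.  When s is nonzero all the y_i
    coincide, which affine independence forbids for two points; when s = 0 also
    v = 0, so c is an affine dependency. *)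
Lemma sqdist_matrix_unit (R : rcfType) (n m : nat) (y : 'I_m -> 'cV[R]_n)
    (rho : R) :
  (forall j, inner (y j) (y j) = rho) ->
  affinely_independent_family y -> (1 < m)%N ->
  sqdist_matrix y \in unitmx.
Proof.
move=> y_sph y_ind m_gt1; apply: unitmx_ker0 => c Dc0.
have [] := circumcenter_eqs y_sph (etrans Dc0 (esym (scale0r _))).
set s := \sum_j _; set v := \sum_j _; rewrite mul0r => total rad.
have yv i : s *: y i = v.
  apply/eqP; rewrite -subr_eq0 -inner_eq0.
  by have := rad i => /esym/eqP; rewrite mulf_eq0 pnatr_eq0.
have s0 : s = 0.
  apply/eqP; apply: contraT => s_neq0.
  pose i0 := Ordinal (ltnW m_gt1); pose i1 := Ordinal m_gt1.
  have y01 : y i0 = y i1 by apply: (scalerI s_neq0); rewrite !yv.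
  (* The difference of two unit vectors is a nonzero affine dependency between
     the coinciding points y i0 and y i1. *)
  pose e : 'cV[R]_m := delta_mx i0 0 - delta_mx i1 0.
  have eE (V : lmodType R) (f : 'I_m -> V) :
      \sum_i e i 0 *: f i = f i0 - f i1.
    rewrite -(sum_delta_scale i0) -(sum_delta_scale i1) -sumrB.
    by apply: eq_bigr => i _; rewrite !mxE !andbT scalerBl.
  have e0 : e = 0.
    apply: y_ind; last by rewrite eE y01 subrr.
    transitivity (\sum_i e i 0 *: (1 : R^o)); last by rewrite eE subrr.
    by apply: eq_bigr => i _; rewrite [RHS]mulr1.
  have := congr1 (fun u : 'cV[R]_m => u i0 0) e0; rewrite !mxE /= subr0.
  by move/eqP; rewrite oner_eq0.
apply: y_ind => //; apply/eqP; rewrite -/v -inner_eq0.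
by move: total; rewrite s0; nra.
Qed.

(** With c the solution of D c = 1, the identity s = 2 |s y_i - v|^2 forces
    s >= 0, and then 2 |v|^2 = s (2 rho s - 1) >= 0 gives the bound, equality
    meaning v = 0.  Conversely, a combination a with sum 1 and barycentre 0
    satisfies D a = 2 rho 1, so a = 2 rho c. *)
Lemma sum_inv_sqdist_matrix (R : rcfType) (n m : nat) (y : 'I_m -> 'cV[R]_n)
    (rho : R) (s := inner (invmx (sqdist_matrix y) *m ones R m) (ones R m)) :
  (forall j, inner (y j) (y j) = rho) ->
  affinely_independent_family y -> (1 < m)%N ->
  (2 * rho)^-1 <= s /\
  (s = (2 * rho)^-1 <->
   exists2 a : 'cV[R]_m, \sum_i a i 0 = 1 & \sum_i a i 0 *: y i = 0).
Proof.
move=> y_sph y_ind m_gt1.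
have D_unit := sqdist_matrix_unit y_sph y_ind m_gt1.
rewrite {}/s inner_ones; set c := _ *m _.
have Dc : sqdist_matrix y *m c = 1 *: ones R m by rewrite mulKVmx // scale1r.
have [] := circumcenter_eqs y_sph Dc.
set s := \sum_j _; set v := \sum_j _; rewrite mul1r => total rad.
have v_ge0 := inner_ge0 v.
have i0 : 'I_m := Ordinal m_gt1.
have row0 : 1 = 2 * rho * s - 2 * inner (y i0) v.
  by rewrite -(sqdist_matrix_mulE _ _ y_sph) Dc !mxE mulr1.
(* If s = 0 then v = 0 as well, and row i0 of D c = 1 would read 0 = 1. *)
have s_neq0 : s != 0.
  apply/eqP => s0; have v0 : v = 0.
    by apply/eqP; rewrite -inner_eq0; apply/eqP; move: total; rewrite s0; lra.
  move: row0; rewrite s0 v0 innerC -(scale0r 0) innerZl; lra.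
have s_gt0 : 0 < s.
  by rewrite lt_neqAle eq_sym s_neq0 (rad i0) mulr_ge0 ?inner_ge0.
have eq_norm : 2 * inner v v = s * (2 * rho * s - 1) by rewrite mulrBr; lra.
have rho_ge : 1 <= 2 * rho * s.
  by rewrite -subr_ge0 -(pmulr_rge0 _ s_gt0) -eq_norm mulr_ge0.
have rho_gt0 : 0 < 2 * rho.
  by rewrite -(pmulr_lgt0 _ s_gt0); apply: lt_le_trans rho_ge.
split; first by rewrite -[leLHS]mulr1 ler_pdivrMl.
split=> [sE | [a a1 ay0]].
  have v0 : v = 0.
    apply/eqP; rewrite -inner_eq0; apply/eqP.
    by move: eq_norm; rewrite [in X in _ * (X - _)]sE divff ?gt_eqF //; lra.
  exists (s^-1 *: c).
    under eq_bigr => i _ do rewrite mxE.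
    by rewrite -mulr_sumr mulVf.
  under eq_bigr => i _ do rewrite mxE -scalerA.
  by rewrite -scaler_sumr -/v v0 scaler0.
have Da : sqdist_matrix y *m a = (2 * rho) *: ones R m.
  apply/matrixP => i j; rewrite ord1 (sqdist_matrix_mulE _ _ y_sph).
  rewrite a1 ay0 innerC -(scale0r 0) innerZl !mxE; ring.
have aE : a = (2 * rho) *: c by rewrite /c scalemxAr -Da mulKmx.
apply: (mulfI (lt0r_neq0 rho_gt0)); rewrite divff ?lt0r_neq0 // -[RHS]a1 aE.
by rewrite mulr_sumr; apply: eq_bigr => i _; rewrite [RHS]mxE.
Qed.

(** * The affine hull of a finite family *)

(** The affine combinations of the p_i form p_0 plus the span of the
    differences p_i - p_0, which is itself one of the affine subspaces over which the
    hull quantifies. *)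
Lemma affine_hull_familyP (R : rcfType) (n m : nat) (p : 'I_m -> 'cV[R]_n)
    (S : 'cV[R]_n -> Prop) (v : 'cV[R]_n) :
  (0 < m)%N -> (forall u, S u <-> exists i, u = p i) ->
  affine_hull S v <->
  exists2 a : 'cV[R]_m, \sum_i a i 0 = 1 & \sum_i a i 0 *: p i = v.
Proof.
move=> m_gt0 SE; split=> [hull_v | [a a1 <-] Z [b [V ZE]] SZ].
  pose i0 := Ordinal m_gt0; pose q := [tuple p i - p i0 | i < m].
  have : v - p i0 \in <<q>>%VS.
    apply: (hull_v (fun u => u - p i0 \in <<q>>%VS)); first by exists (p i0), <<q>>%VS.
    move=> _ /SE[i ->]; apply: memv_span; apply/tnthP; exists i.
    by rewrite tnth_mktuple.
  move=> /coord_span vE.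
  pose b i := coord q i (v - p i0).
  have {}vE : v = p i0 + \sum_i b i *: (p i - p i0).
    rewrite -[LHS](subrK (p i0)) addrC {1}vE; congr (_ + _).
    by apply: eq_bigr => i _; rewrite -tnth_nth tnth_mktuple.
  (* The base point p i0 absorbs the weight missing from the coordinates b. *)
  exists (\col_i ((i == i0)%:R * (1 - \sum_j b j) + b i)).
    under eq_bigr => i _ do rewrite mxE.
    by rewrite big_split /= (sum_delta_scale i0 (fun=> _ : R^o)) subrK.
  under eq_bigr => i _ do rewrite mxE scalerDl -scalerA.
  rewrite big_split /= sum_delta_scale vE.
  under [in RHS]eq_bigr => i _ do rewrite scalerBr.
  by rewrite sumrB -scaler_suml scalerBl scale1r addrA addrAC.
apply/ZE; have -> : \sum_i a i 0 *: p i - b = \sum_i a i 0 *: (p i - b).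
  under [RHS]eq_bigr => i _ do rewrite scalerBr.
  by rewrite sumrB -scaler_suml a1 scale1r.
by apply: memv_suml => i _; apply: memvZ; apply/ZE/SZ/SE; exists i.
Qed.

(** * The weighted cube *)

Lemma iota_wE (R : rcfType) (n : nat) (w : 'I_n -> R) (x : 'cV[R]_n) k :
  iota_w w x k 0 = (Num.sqrt (w k))^-1 * x k 0.
Proof. by rewrite /iota_w mul_diag_mx !mxE. Qed.

(** Each coordinate difference is 0 or w k in absolute value, and on these two
    values t |-> t and t |-> t^2 / w k agree. *)
Lemma l1dist_cubeE (R : rcfType) (n : nat) (w : 'I_n -> R) (x y : 'cV[R]_n) :
  (forall k, 0 < w k) -> weighted_cube w x -> weighted_cube w y ->
  l1dist x y = inner (iota_w w x - iota_w w y) (iota_w w x - iota_w w y).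
Proof.
move=> w_gt0 /forallP xc /forallP yc; apply: eq_bigr => k _.
rewrite cVsubE !iota_wE -mulrBr mulrACA -expr2 exprVn.
rewrite sqr_sqrtr ?ltW // -expr2.
have wk := w_gt0 k; have w0 : w k != 0 by rewrite gt_eqF.
by case/orP: (xc k) => /eqP ->; case/orP: (yc k) => /eqP ->;
  rewrite ?subrr ?subr0 ?sub0r ?normrN ?sqrrN ?normr0 ?expr0n ?mulr0 //
          gtr0_norm // expr2 mulKf.
Qed.

(** The coordinates of iota x are 0 or sqrt (w k), both at distance
    sqrt (w k) / 2 from the coordinate of h. *)
Lemma iota_w_sphere (R : rcfType) (n : nat) (w : 'I_n -> R) (x : 'cV[R]_n) :
  (forall k, 0 < w k) -> weighted_cube w x ->
  inner (iota_w w x - h_vec w) (iota_w w x - h_vec w) = (\sum_k w k) / 4.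
Proof.
move=> w_gt0 /forallP xc; rewrite mulr_suml; apply: eq_bigr => k _.
rewrite cVsubE iota_wE !mxE.
have rw : Num.sqrt (w k) != 0 by rewrite gt_eqF ?sqrtr_gt0.
rewrite -[in RHS](sqr_sqrtr (ltW (w_gt0 k))).
case/orP: (xc k) => /eqP ->; first by field.
by rewrite -[X in _^-1 * X](sqr_sqrtr (ltW (w_gt0 k))); field.
Qed.

Lemma sum_iota_w (R : rcfType) (n m : nat) (w : 'I_n -> R)
    (c : 'I_m -> R) (x : 'I_m -> 'cV[R]_n) :
  \sum_i c i *: iota_w w (x i) = iota_w w (\sum_i c i *: x i).
Proof.
by rewrite /iota_w mulmx_sumr; apply: eq_bigr => i _; rewrite scalemxAr.
Qed.

Lemma iota_w_eq0 (R : rcfType) (n : nat) (w : 'I_n -> R) (x : 'cV[R]_n) :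
  (forall k, 0 < w k) -> iota_w w x = 0 -> x = 0.
Proof.
move=> w_gt0 x0; apply/matrixP => k j; rewrite ord1 mxE.
have /eqP := congr1 (fun u : 'cV[R]_n => u k 0) x0.
rewrite iota_wE mxE mulf_eq0 invr_eq0 gt_eqF ?sqrtr_gt0 //=; exact: eqP.
Qed.

(** Coefficients indexed by positions in the enumeration extend to a function
    on points, since each point has a single position. *)
Lemma affinely_independent_enum (R : rcfType) (n : nat) (X : {fset 'cV[R]_n}) :
  affinely_independent X ->
  affinely_independent_family (fun i : 'I_#|` X| => (enum_fset X)`_i).
Proof.
move=> X_ind c c0 cx0; set e := enum_fset X in cx0 *.
have sumE (V : nmodType) (F : R -> 'cV[R]_n -> V) :
    \sum_(x <- e) F (if insub (index x e) is Some i then c i 0 else 0) x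
    = \sum_(i < #|` X|) F (c i 0) e`_i.
  rewrite (big_nth 0) big_mkord; apply: eq_bigr => i _.
  by rewrite index_uniq ?fset_uniq ?ltn_ord // valK.
apply/matrixP => i j; rewrite ord1 mxE.
pose c' x := if insub (index x e) is Some i then c i 0 else 0.
have := X_ind c' _ _ e`_i; rewrite /c' index_uniq ?fset_uniq ?ltn_ord // valK.
apply.
- by rewrite (sumE _ (fun a _ => a)).
- by rewrite (sumE _ (fun a x => a *: x)).
- exact: mem_nth.
Qed.

Unset Implicit Arguments.
Set Strict Implicit.

Theorem corollary5p5 (R : rcfType) (n : nat) (w : 'I_n -> R)
    (w_gt0 : forall k, 0 < w k)
    (X : {fset 'cV[R]_n})
    (X_cube : forall x, x \in X -> weighted_cube w x)
    (X_indep : affinely_independent X)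
    (X_card : (2 <= #|` X|)%N) :
  inner (invmx (distance_matrix X) *m ones R #|` X|) (ones R #|` X|)
    >= 2 * (\sum_k w k)^-1
  /\ (inner (invmx (distance_matrix X) *m ones R #|` X|) (ones R #|` X|)
        = 2 * (\sum_k w k)^-1
      <-> Z_of w X (h_vec w)).
Proof.
pose x (i : 'I_#|` X|) := (enum_fset X)`_i.
have x_in i : x i \in X by apply: mem_nth.
pose p i := iota_w w (x i); pose y i := p i - h_vec w.
have y_sph i : inner (y i) (y i) = (\sum_k w k) / 4.
  by apply: iota_w_sphere => //; apply: X_cube.
have sum_y (c : 'cV[R]_#|` X|) :
    \sum_i c i 0 *: y i = \sum_i c i 0 *: p i - (\sum_i c i 0) *: h_vec w.
  by rewrite scaler_suml -sumrB; apply: eq_bigr => i _; rewrite scalerBr.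
have y_ind : affinely_independent_family y.
  move=> c c0; rewrite sum_y c0 scale0r subr0 sum_iota_w => cx0.
  by apply: (affinely_independent_enum X_indep c0); apply: iota_w_eq0 cx0.
have DE : distance_matrix X = sqdist_matrix y.
  apply/matrixP => i j; rewrite !mxE -/(x i) -/(x j).
  rewrite (l1dist_cubeE w_gt0 (X_cube _ (x_in i)) (X_cube _ (x_in j))).
  by rewrite /y opprB addrA subrK.
have hull : Z_of w X (h_vec w) <->
    exists2 a : 'cV[R]_#|` X|, \sum_i a i 0 = 1 & \sum_i a i 0 *: y i = 0.
  have SE u : (exists2 x, x \in X & u = iota_w w x) <-> exists i, u = p i.
    split=> [[z z_in ->] | [i ->]]; last by exists (x i).
    have iz : (index z (enum_fset X) < #|` X|)%N by rewrite index_mem.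
    by exists (Ordinal iz); rewrite /p /x nth_index.
  split=> [/(affine_hull_familyP _ (ltnW X_card) SE)[a a1 ah] | [a a1]].
    by exists a; rewrite // sum_y a1 scale1r ah subrr.
  rewrite sum_y a1 scale1r => /subr0_eq ah.
  by apply/(affine_hull_familyP _ (ltnW X_card) SE); exists a.
(* The bound is 1 / (2 rho) for the squared radius rho of [iota_w_sphere]. *)
have -> : 2 * (\sum_k w k)^-1 = (2 * ((\sum_k w k) / 4))^-1.
  have -> : 2 * ((\sum_k w k) / 4) = 2^-1 * \sum_k w k :> R by field.
  by rewrite invfM invrK.
rewrite DE; have [le_s eq_s] := sum_inv_sqdist_matrix y_sph y_ind X_card.
by split=> //; apply: (iff_trans eq_s); apply: iff_sym.
Qed.
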